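(* Let $n$ be a positive integer. At least one of $r_n$ or $s_n$ has a non-zero $n$-th digit from the right in base $10$, meaning that at least one of $r_n$ or $s_n$ is an integer with exactly $n$ digits in base $10$.
   Context: For each integer $n\ge 2$, let $a_n=5^{n2^{n-2}}$ and $b_n=1-a_n$, and let $r_n$ and $s_n$ be the remainders of $a_n$ and $b_n$, respectively, modulo $10^n$; that is, $r_n,s_n$ are the integers with $0\le r_n,s_n<10^n$, $r_n\equiv a_n\pmod{10^n}$ and $s_n\equiv b_n\pmod{10^n}$. For $n=1$, set $r_1=5$ and $s_1=6$. *)

(* Defs.v *)
From mathcomp Require Import all_boot all_order all_algebra.

Set Implicit Arguments.
Unset Strict Implicit.
Unset Printing Implicit Defensive.

Import GRing.Theory.
Local Open Scope ring_scope.

Definition a (n : nat) : int := 5 ^+ (n * 2 ^ (n - 2))%N.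

Definition b (n : nat) : int := 1 - a n.

(* [b n] is negative, but [(_ %% _)%Z] is the remainder in [0, 10 ^ n).
   The values at [n = 0] are irrelevant. *)
Definition r (n : nat) : int := if n == 1%N then 5 else (a n %% 10 ^+ n)%Z.

Definition s (n : nat) : int := if n == 1%N then 6 else (b n %% 10 ^+ n)%Z.

(* Positions are counted from 1, the units digit being the first;
   the digit is 0 at positions beyond the leading one. *)
Definition digit_from_right (k m : nat) : nat := ((m %/ 10 ^ (k - 1)) %% 10)%N.

(* [Nat.to_uint] writes no leading zeros (and 0 is written with one digit). *)
Definition number_of_digits (m : nat) : nat := Decimal.nb_digits (Nat.to_uint m).

(* Main.v *)
From Stdlib Require Import DecimalFacts DecimalNat.
Require Import Defs.
From mathcomp Require Import all_boot all_order all_algebra.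
From mathcomp Require Import zify.

(** If [r n] and [s n] both had fewer than [n] digits, their sum would be at
    most [10 ^ n]. But [a n + b n = 1], so [r n + s n] is [1] or [10 ^ n + 1],
    and it is not [1] because [a n] is odd and divisible by 5, which prevents
    [r n] from being [0] or [1]. *)

Import Order.TTheory GRing.Theory Num.Theory.

(** [acc] is the value of the digits already read; the remaining digits [d] shift it by their length
    and add less than one unit of that power of 10. *)
Lemma of_uint_acc_bounds (d : Decimal.uint) (acc : nat) :
  acc * 10 ^ Decimal.nb_digits d <= Nat.of_uint_acc d acc
    < acc.+1 * 10 ^ Decimal.nb_digits d.
Proof.
elim: d acc => [|d IHd|d IHd|d IHd|d IHd|d IHd|d IHd|d IHd|d IHd|d IHd|d IHd] acc;
  rewrite [Decimal.nb_digits _]/= ?expnS ?expn0; first by rewrite /=; lia.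
all: rewrite [Nat.of_uint_acc _ _]/= PeanoNat.Nat.tail_mul_spec.
all: set x := (X in Nat.of_uint_acc _ X); have := IHd x.
all: move: (10 ^ _) => e; subst x; nia.
Qed.

(** [Nat.to_uint m] is normalized, so for positive [m] it starts with a digit from 1 to 9. With that
    digit as accumulator, the preceding bounds enclose [m] between consecutive powers of 10. *)
Lemma number_of_digitsE (m : nat) :
  0 < m -> number_of_digits m = (trunc_log 10 m).+1.
Proof.
rewrite /number_of_digits => m_gt0.
have of_d := Unsigned.of_to m; have norm_d := Unsigned.to_of (Nat.to_uint m).
rewrite of_d in norm_d.
case def_d: (Nat.to_uint m) of_d norm_d => [|u|u|u|u|u|u|u|u|u|u] of_d norm_d.
- by case: (unorm_nonnil _ (esym norm_d)).
(* A leading zero is impossible: normalizing [u] would give back [D0 u], yet it never lengthens a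
   nonempty digit string. *)
- rewrite unorm_D0 in norm_d.
  have u_nnil : u <> Decimal.Nil by move=> u0; move: m_gt0; rewrite -of_d u0.
  have := nb_digits_unorm u u_nnil; rewrite -norm_d /=; lia.
all: rewrite [Decimal.nb_digits _]/=; congr S; apply/esym/trunc_log_eq => //.
all: rewrite -of_d /Nat.of_uint [Nat.of_uint_acc _ 0]/=.
all: set x := (X in Nat.of_uint_acc _ X); have := of_uint_acc_bounds u x.
all: rewrite {}/x PeanoNat.Nat.tail_mul_spec expnS; move: (10 ^ _) => e; lia.
Qed.

Lemma leading_digit (n m : nat) : 0 < n -> 10 ^ n.-1 <= m < 10 ^ n ->
  digit_from_right n m <> 0 /\ number_of_digits m = n.
Proof.
case: n => // n _ /= /andP[le_m lt_m].
have m_gt0 : 0 < m by apply: leq_trans le_m; rewrite expn_gt0.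
split; last first.
  by rewrite number_of_digitsE // (@trunc_log_eq 10 n m) ?le_m.
have e_gt0 : 0 < 10 ^ n by rewrite expn_gt0.
(* The quotient by [10 ^ n] is already below 10, so it is itself the digit. *)
rewrite /digit_from_right subn1 /= modn_small ?ltn_divLR // -?expnS //.
by apply/eqP; rewrite -lt0n divn_gt0.
Qed.

Local Open Scope ring_scope.

Lemma modz_complement (x q : int) : 1 < (x %% q)%Z -> 0 < q ->
  ((1 - x) %% q)%Z = q + 1 - (x %% q)%Z.
Proof.
move=> x_gt1 q_gt0; have x_ltq := ltz_pmod x q_gt0.
(* A remainder above 1 is exactly what keeps [q + 1 - (x %% q)] below [q]. *)
rewrite -(@modz_small (q + 1 - (x %% q)%Z) q); last by apply/andP; split; lia.
apply/eqP; rewrite eqz_mod_dvd {1}(divz_eq x q).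
apply/dvdzP; exists (- (x %/ q)%Z - 1); move: (_ %/ _)%Z (_ %% _)%Z => y z; lia.
Qed.

(** As 10 divides [q], reduction modulo [q] preserves residues modulo 2 and 5; neither 0 nor 1 is an
    odd multiple of 5. *)
Lemma modz_odd_mul5_gt1 (x q : int) :
  0 < q -> (10 %| q)%Z -> ~~ (2 %| x)%Z -> (5 %| x)%Z -> 1 < (x %% q)%Z.
Proof.
move=> q_gt0 /dvdzP[t q_def] x_odd x5.
have q_neq0 : q != 0 by rewrite gt_eqF.
have := modz_ge0 x q_neq0; have := divz_eq x q.
rewrite {2}q_def mulrA; move: ((_ %/ q)%Z * t) (_ %% q)%Z => y z; lia.
Qed.

Theorem theorem4 (n : nat) (n_gt0 : (0 < n)%N) :
  (digit_from_right n `|r n|%N <> 0%N /\ number_of_digits `|r n|%N = n) \/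
  (digit_from_right n `|s n|%N <> 0%N /\ number_of_digits `|s n|%N = n).
Proof.
case: (eqVneq n 1%N) => [-> | n_neq1]; first by left.
have n_ge2 : (1 < n)%N by lia.
have q_gt0 : 0 < 10 ^+ n :> int by rewrite exprn_gt0.
have q10 : (10 %| 10 ^+ n)%Z by rewrite dvdz_exp.
have e_gt0 : (0 < n * 2 ^ (n - 2))%N by rewrite muln_gt0 n_gt0 expn_gt0.
have a5 : (5 %| a n)%Z by rewrite dvdz_exp.
have a_odd : ~~ (2 %| a n)%Z by rewrite /a dvdzE abszX dvdn2 negbK oddX orbT.
have a_gt1 := modz_odd_mul5_gt1 _ _ q_gt0 q10 a_odd a5.
have b_mod := modz_complement _ _ a_gt1 q_gt0.
have a_ltq := ltz_pmod (a n) q_gt0.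
have qE : 10 ^+ n = (10 ^ n)%N :> int by rewrite -natrX natz.
have qS : (10 ^ n = 10 * 10 ^ n.-1)%N by rewrite -expnS prednK.
rewrite /r /s (negPf n_neq1) /b b_mod.
(* When [r n] is below [10 ^ n.-1], the complement [10 ^ n + 1 - r n] exceeds [9 * 10 ^ n.-1]; it is
   below [10 ^ n] because [r n] exceeds 1. *)
case: (leqP (10 ^ n.-1) `|(a n %% 10 ^+ n)%Z|) => [a_ge | a_lt]; [left | right];
  apply: leading_digit => //; move: a_gt1 a_ltq; rewrite qE; lia.
Qed.
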